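(* Let $d\ge 1$ and let $T=\{\mathbf t_1,\dots,\mathbf t_s\}\subset\mathbb Z^d$ be a configuration in general position (so $s\ge d+2$ and every $d$ of the vectors $\mathbf t_1,\dots,\mathbf t_s$ are linearly independent over $\mathbb Q$) such that the cone $\mathrm{pos}_{\mathbb Q}(T)$ has a vertex. Then the strongly robust complex $\Delta_T$ of the (simple) toric ideal $I_T$ satisfies $$\dim(\Delta_T)<\operatorname{rank}(T).$$
   Context: A configuration of vectors $\{\mathbf t_1,\dots,\mathbf t_s\}\subset\mathbb Z^m$ is identified with the $m\times s$ integer matrix with columns $\mathbf t_1,\dots,\mathbf t_s$, and $\operatorname{rank}(T)$ is the rank of this matrix. Write $[s]=\{1,\dots,s\}$. General position: a configuration $A=\{\mathbf a_1,\dots,\mathbf a_n\}\subset\mathbb Z^d$ is in general position if $n\ge d+2$ and every $d$ of its elements are linearly independent in $\mathbb Q^d$. The cone $\mathrm{pos}_{\mathbb Q}(A)=\{\sum_i\lambda_i\mathbf a_i:\lambda_i\in\mathbb Q_{\ge0}\}$ has a vertex if it is pointed, i.e. contains no line; in this situation $\operatorname{Ker}_{\mathbb Z}(A)\cap\mathbb N^n=\{\mathbf 0\}$, where $\operatorname{Ker}_{\mathbb Z}(A)=\{\mathbf u\in\mathbb Z^n: A\mathbf u=\mathbf 0\}$. For an integer matrix $A$ with $n$ columns and $\operatorname{Ker}_{\mathbb Z}(A)\cap\mathbb N^n=\{\mathbf 0\}$, the toric ideal $I_A\subset K[x_1,\dots,x_n]$ ($K$ a field) is generated by the binomials $x^{\mathbf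 u^+}-x^{\mathbf u^-}$, $\mathbf u\in\operatorname{Ker}_{\mathbb Z}(A)$, where $\mathbf u=\mathbf u^+-\mathbf u^-$ with $\mathbf u^\pm$ nonnegative of disjoint supports. For $\mathbf u,\mathbf v,\mathbf w\in\operatorname{Ker}_{\mathbb Z}(A)$ with $\mathbf u=\mathbf v+\mathbf w$: the sum is a conformal decomposition if $\mathbf u^+=\mathbf v^++\mathbf w^+$ and $\mathbf u^-=\mathbf v^-+\mathbf w^-$; it is a semiconformal decomposition if for every $i$, $v_i>0$ implies $w_i\ge0$, and $w_i<0$ implies $v_i\le0$. A decomposition is proper if $\mathbf v\ne\mathbf 0$ and $\mathbf w\ne\mathbf 0$. $\operatorname{Gr}(A)$ (Graver basis) is the set of nonzero $\mathbf u\in\operatorname{Ker}_{\mathbb Z}(A)$ with no proper conformal decomposition, and $S(A)$ (indispensable elements) is the set of nonzero $\mathbf u\in\operatorname{Ker}_{\mathbb Z}(A)$ with no proper semiconformal decomposition. The binomials $x^{\mathbf u^+}-x^{\mathbf u^-}$ with $\mathbf u\in\operatorname{Gr}(A)$ form the Graver basis of $I_A$, and those with $\mathbf u\in S(A)$ are the indispensable binomials of $I_A$. The ideal $I_A$ is strongly robust if its set of indispensable binomials equals its Graver basis, i.e. $S(A)=\operatorname{Gr}(A)$. Simple: $A$ (equivalently $I_A$) is simple if all its bouquets are singletons, i.e. there is no co-vector of $A$ (a vector $(\mathbf c\cdot\mathbf a_1,\dots,\mathbf c\cdot\mathbf a_n)$ with $\mathbf c$ an integer vector) whose support consists of exactly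 two indices. Strongly robust complex: let $T$ be a simple $m\times s$ integer matrix and let $\Lambda(T)=\begin{pmatrix}T&0\\ I_s&I_s\end{pmatrix}$, an $(m+s)\times 2s$ matrix. For $\omega\subseteq[s]$, let $\Lambda(T)_\omega$ be obtained from $\Lambda(T)$ by deleting, for each $i\in\omega$, the $(m+i)$-th row and the $(s+i)$-th column. Then $\Delta_T=\{\omega\subseteq[s]: I_{\Lambda(T)_\omega}\text{ is strongly robust}\}$. This is a simplicial complex, and $\dim\Delta_T=\max\{|\omega|-1:\omega\in\Delta_T\}$. *)

(* Defs.v *)
From HB Require Import structures.
From mathcomp Require Import all_boot all_order all_algebra.
From mathcomp Require Import boolp.

Set Implicit Arguments.
Unset Strict Implicit.
Unset Printing Implicit Defensive.

Import Order.TTheory GRing.Theory Num.Theory.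
Local Open Scope ring_scope.

(* A configuration of n vectors of Z^m is the matrix having them as columns. *)

Definition ratmx m n (A : 'M[int]_(m, n)) : 'M[rat]_(m, n) :=
  map_mx (intr : int -> rat) A.

Definition general_position d n (A : 'M[int]_(d, n)) : Prop :=
  (d + 2 <= n)%N /\
  forall f : 'I_d -> 'I_n, injective f -> row_free (colsub f (ratmx A))^T.

Definition pos_cone d n (A : 'M[int]_(d, n)) (x : 'cV[rat]_d) : Prop :=
  exists l : 'cV[rat]_n, (forall i, 0 <= l i 0) /\ x = ratmx A *m l.

Definition has_vertex d n (A : 'M[int]_(d, n)) : Prop :=
  ~ exists p v : 'cV[rat]_d,
      v != 0 /\ forall t : rat, pos_cone A (p + t *: v).

(* Every bouquet of A is a singleton. *)
Definition simple m n (A : 'M[int]_(m, n)) : Prop :=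
  ~ exists c : 'rV[int]_m, #|[set i | (c *m A) 0 i != 0]| = 2%N.

Definition in_ker m n (A : 'M[int]_(m, n)) (u : 'cV[int]_n) : Prop :=
  A *m u = 0.

Definition pos_part n (u : 'cV[int]_n) : 'cV[int]_n :=
  map_mx (fun x => Num.max x 0) u.

Definition neg_part n (u : 'cV[int]_n) : 'cV[int]_n :=
  map_mx (fun x => Num.max (- x) 0) u.

Definition conformal n (v w : 'cV[int]_n) : Prop :=
  pos_part (v + w) = pos_part v + pos_part w /\
  neg_part (v + w) = neg_part v + neg_part w.

Definition semiconformal n (v w : 'cV[int]_n) : Prop :=
  forall i, (0 < v i 0 -> 0 <= w i 0) /\ (w i 0 < 0 -> v i 0 <= 0).

Definition has_proper_decomposition m n (A : 'M[int]_(m, n))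
    (R : 'cV[int]_n -> 'cV[int]_n -> Prop) (u : 'cV[int]_n) : Prop :=
  exists v w : 'cV[int]_n,
    [/\ in_ker A v /\ in_ker A w, v != 0 /\ w != 0, u = v + w & R v w].

Definition graver m n (A : 'M[int]_(m, n)) (u : 'cV[int]_n) : Prop :=
  [/\ in_ker A u, u != 0 & ~ has_proper_decomposition A (@conformal n) u].

Definition indispensable m n (A : 'M[int]_(m, n)) (u : 'cV[int]_n) : Prop :=
  [/\ in_ker A u, u != 0 & ~ has_proper_decomposition A (@semiconformal n) u].

(* Identifying u with the binomial x^(u+) - x^(u-), S(A) = Gr(A) says that the
   indispensable binomials of the toric ideal of A form its Graver basis. *)
Definition strongly_robust m n (A : 'M[int]_(m, n)) : Prop :=
  forall u, indispensable A u <-> graver A u.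

Definition Lambda m s (T : 'M[int]_(m, s)) : 'M[int]_(m + s, s + s) :=
  block_mx T 0 1%:M 1%:M.

Definition delete m n (R : {set 'I_m}) (C : {set 'I_n}) (A : 'M[int]_(m, n)) :
    'M[int]_(#|~: R|, #|~: C|) :=
  mxsub (fun i : 'I_#|~: R| => enum_val i) (fun j : 'I_#|~: C| => enum_val j) A.

Definition Lambda_del m s (T : 'M[int]_(m, s)) (w : {set 'I_s}) :=
  delete [set rshift m i | i in w] [set rshift s i | i in w] (Lambda T).

Definition strongly_robust_complex m s (T : 'M[int]_(m, s)) : {set {set 'I_s}} :=
  [set w : {set 'I_s} | `[< strongly_robust (Lambda_del T w) >]].

(* The maximum of #|w| - 1 over the faces w; it is -1 for the complex {set0}
   (and, by convention, for the void family), hence the values in int. *)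
Definition complex_dim (s : nat) (D : {set {set 'I_s}}) : int :=
  (\max_(w in D) #|w|)%N%:Z - 1.

(* Matrices in general position are simple, so that the strongly robust complex
   is only considered for simple matrices. *)
Lemma general_position_simple d n (A : 'M[int]_(d, n)) :
  general_position A -> simple A.
Proof.
move=> [dn free_A] [c supp2].
set S := [set i | (c *m A) 0 i != 0] in supp2.
have le_d : (d <= #|~: S|)%N.
  rewrite cardsCs setCK card_ord supp2 -(leq_add2r 2) subnK //.
  by apply: leq_trans dn; rewrite leq_addl.
pose f (i : 'I_d) : 'I_n := enum_val (widen_ord le_d i).
have inj_f : injective f.
  by move=> i j /enum_val_inj /(congr1 val) /= /val_inj.
have c0 : ratmx c = 0.
  have: ratmx c *m colsub f (ratmx A) = 0.
    rewrite mulmx_colsub -map_mxM; apply/rowP=> i; rewrite !mxE.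
    have := enum_valP (widen_ord le_d i); rewrite !inE negbK -/(f i) => /eqP.
    by rewrite !mxE => ->.
  move/(congr1 trmx); rewrite trmx_mul trmx0 => Ac0.
  have := free_A f inj_f; rewrite row_free_unit unitmx_tr => uA.
  apply: trmx_inj; rewrite trmx0.
  by rewrite -[LHS](mulKmx (_ : (colsub f (ratmx A))^T \in unitmx)) ?unitmx_tr // Ac0 mulmx0.
have {}c0 : c = 0.
  by apply/rowP=> i; have /rowP/(_ i) := c0; rewrite !mxE => /eqP;
     rewrite intr_eq0 => /eqP.
suff S0 : S = set0 by rewrite S0 cards0 in supp2.
by apply/setP=> i; rewrite !inE c0 mul0mx mxE eqxx.
Qed.

(* Main.v *)
(* The kernel of Lambda(T)_W is Ker T, embedded by u |-> (u, -u); under this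
   embedding a decomposition is semiconformal when it is semiconformal on W and
   conformal off W.  If |W| > d, choose d + 1 indices w in W and one further
   index e; the kernel elements supported on w + {e} form a lattice of rank 2 in
   which a nonzero element has at most one zero coordinate.  For i in w let r_i
   be its primitive element with i-th coordinate 0 and positive e-th coordinate.
   Choosing i to maximize the e-th coordinate of r_i, one writes r_i = h + g
   with 0 <= h_e < (r_i)_e and {h, r_i} a basis of the lattice: if h or g differed
   in sign from r_i at some k <> i, then r_k would be a combination of r_i and
   that element with coefficients >= 1, and would have a larger e-th
   coordinate.  So h and g disagree in sign only at i, and h + g or g + h is
   semiconformal on w, although the circuit r_i lies in the Graver basis. *)
Require Import Defs.
From mathcomp Require Import all_boot all_order all_algebra.
From mathcomp Require Import boolp zify ring.
Set Implicit Arguments.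
Import Order.TTheory GRing.Theory Num.Theory.
Local Open Scope ring_scope.

(** * Integer kernel vectors and general position *)

Lemma int_col_denominator n (y : 'cV[rat]_n) :
  exists2 N : int, N != 0 & exists z : 'cV[int]_n, N%:~R *: y = map_mx intr z.
Proof.
exists (\prod_i denq (y i 0)).
  by apply/prodf_neq0 => i _; rewrite denq_neq0.
exists (\col_i (numq (y i 0) * \prod_(j | j != i) denq (y j 0))).
apply/colP => i; rewrite !mxE (bigD1 i) //= !intrM -{2}(divq_num_den (y i 0)).
by rewrite mulrAC; congr (_ * _); rewrite mulrC divfK // intr_eq0 denq_neq0.
Qed.

Lemma ratmx_inj m n : injective (@ratmx m n).
Proof.
move=> A B /matrixP AB; apply/matrixP => i j.
by have := AB i j; rewrite !mxE => /intr_inj.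
Qed.

Lemma int_ker_neq0 m n (A : 'M[int]_(m, n)) :
  (m < n)%N -> exists2 u : 'cV[int]_n, u != 0 & A *m u = 0.
Proof.
move=> lt_mn; pose B := (ratmx A)^T.
have /rowV0Pn [y yB y0] : kermx B != 0.
  rewrite kermx_eq0 /row_free neq_ltn (leq_ltn_trans (rank_leq_col B)) //.
have [N N0 [z Nyz]] := int_col_denominator y^T.
exists z.
  apply: contraNneq y0 => z0; move: Nyz; rewrite z0 map_mx0 => /eqP.
  rewrite scaler_eq0 intr_eq0 (negPf N0) /= => /eqP yT0.
  by rewrite -(trmxK y) yT0 trmx0.
have Ay : ratmx A *m y^T = 0.
  by apply: trmx_inj; rewrite trmx_mul trmxK trmx0; exact/sub_kermxP.
apply: ratmx_inj; rewrite /ratmx map_mx0 map_mxM -Nyz -scalemxAr.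
by rewrite -/(ratmx A) Ay scaler0.
Qed.

Lemma exists_dependency m n (A : 'M[int]_(m, n)) (S : {set 'I_n}) :
  (m < #|S|)%N ->
  exists2 u : 'cV[int]_n, u != 0 &
    A *m u = 0 /\ forall k, k \notin S -> u k 0 = 0.
Proof.
move=> mS; pose g (i : 'I_#|~: S|) : 'I_n := enum_val i.
(* The rows of the identity outside [S] are stacked under [A] to force zeros there; the result still
   has fewer than [n] rows. *)
have [|u u0] := @int_ker_neq0 _ _ (col_mx A (rowsub g 1%:M)).
  by have := cardsC S; rewrite card_ord; lia.
rewrite mul_col_mx mul_rowsub_mx mul1mx -(col_mx0 _ m #|~: S|).
move=> /eq_col_mx [Au gu].
exists u => //; split=> // k kS; have kC : k \in ~: S by rewrite inE.
have /colP/(_ (enum_rank_in kC k)) := gu.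
by rewrite !mxE /g enum_rankK_in.
Qed.

Lemma general_position_ker d n (A : 'M[int]_(d, n)) (S : {set 'I_n})
    (u : 'cV[int]_n) :
  general_position A -> #|S| = d -> A *m u = 0 ->
  (forall k, k \notin S -> u k 0 = 0) -> u = 0.
Proof.
(* Replacing [d] by [#|S|] makes the columns indexed by [S] a square matrix. *)
move=> [_ freeA] Sd; case: _ / Sd A freeA => A freeA Au uS.
pose f (i : 'I_#|S|) : 'I_n := enum_val i.
have uA : colsub f (ratmx A) \in unitmx.
  by rewrite -unitmx_tr -row_free_unit; apply: freeA; apply: enum_val_inj.
have Aru : colsub f (ratmx A) *m rowsub f (ratmx u) = 0.
  have := congr1 (map_mx (intr : int -> rat)) Au; rewrite map_mx0 => Ru.
  rewrite -Ru map_mxM; apply/colP=> a; rewrite !mxE.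
  rewrite [RHS](bigID [in S]) /= [X in _ = _ + X]big1 ?addr0; last first.
    by move=> k /uS uk; rewrite !mxE uk mulr0.
  by rewrite [RHS]big_enum_val; apply: eq_bigr => i _; rewrite !mxE.
have ru0 : rowsub f (ratmx u) = 0 by rewrite -(mulKmx uA (rowsub _ _)) Aru mulmx0.
apply/colP => k; rewrite mxE; have [kS|/uS //] := boolP (k \in S).
have /colP/(_ (enum_rank_in kS k)) := ru0.
by rewrite !mxE /f enum_rankK_in // => /eqP; rewrite intr_eq0 => /eqP.
Qed.

Lemma general_position_rank d n (A : 'M[int]_(d, n)) :
  general_position A -> \rank (ratmx A) = d.
Proof.
move=> [dn freeA]; apply/eqP; rewrite eqn_leq rank_leq_row /=.
have le_dn : (d <= n)%N by apply: leq_trans dn; rewrite leq_addr.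
have /freeA : injective (widen_ord le_dn) by move=> i j [/val_inj].
rewrite /row_free mxrank_tr => /eqP {1}<-.
have -> : colsub (widen_ord le_dn) (ratmx A)
        = ratmx A *m colsub (widen_ord le_dn) 1%:M.
  by rewrite mulmx_colsub mulmx1.
exact: mxrankM_maxl.
Qed.

(** * Lattices of rank two and their circuits *)

(** The [k]-th coordinates form a nonzero subgroup of the integers, generated by its least positive
    element: a nonzero remainder would be smaller. *)
Lemma exists_coord_generator n (P : 'cV[int]_n -> Prop) (k : 'I_n) :
  (forall a b u v, P u -> P v -> P (a *: u + b *: v)) ->
  (exists2 u, P u & u k 0 != 0) ->
  exists r, [/\ P r, 0 < r k 0 & forall v, P v -> (r k 0%R %| v k 0%R)%Z].
Proof.
move=> PD [u Pu uk].
have exm : exists m, `[< exists2 x, P x & x k 0 = m.+1 >].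
  exists (`|u k 0%R|.-1)%N; apply/asboolP.
  exists (Num.sg (u k 0) *: u + 0 *: u); first exact: PD.
  by rewrite !mxE mul0r addr0 -normrEsg; lia.
have [m /asboolP [r Pr rk] min_m] := ex_minnP exm.
exists r; split=> [//||v Pv]; first by rewrite rk.
apply: contraT => ndvd.
have [x Px xk] : exists2 x, P x & x k 0 = (v k 0%R %% r k 0%R)%Z.
  exists (1 *: v + (- (v k 0%R %/ r k 0%R)%Z) *: r); first exact: PD.
  by rewrite !mxE /modz; ring.
have ltx : x k 0 < r k 0 by rewrite xk ltz_pmod // rk.
have ge0x : 0 <= x k 0 by rewrite xk modz_ge0 // rk.
have nz : x k 0 != 0 by apply: contraNneq ndvd => x0; apply/dvdz_mod0P; rewrite -xk.
have /min_m : `[< exists2 y, P y & y k 0 = (`|x k 0%R|.-1).+1%N >].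
  by apply/asboolP; exists x => //; lia.
lia.
Qed.

(** [L] abstracts the kernel vectors supported on [e |: w]. Rank 2 is encoded by two hypotheses: two
    zeros on [e |: w] force the vector 0, and a single zero can be prescribed anywhere. The
    multiples clause makes [v + v'] the primitive circuit vanishing at [i]; [v i 0 < 0] fixes the
    order of summands that semiconformality requires. *)
Lemma exists_decomposable_circuit n (L : 'cV[int]_n -> Prop) (w : {set 'I_n})
    (e : 'I_n) :
  (forall a b u v, L u -> L v -> L (a *: u + b *: v)) ->
  (forall u i k, L u -> i \in e |: w -> k \in e |: w -> i != k ->
     u i 0 = 0 -> u k 0 = 0 -> u = 0) ->
  (forall i, i \in e |: w -> exists2 u, L u & u != 0 /\ u i 0 = 0) ->
  e \notin w -> w != set0 ->
  exists i v v', [/\ i \in w, L v, L v',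
    [/\ v i 0 < 0, v i 0 + v' i 0 = 0 & 0 < v e 0 + v' e 0] &
    (forall x, L x -> x i 0 = 0 -> exists q, x = q *: (v + v')) /\
    (forall k, k \in e |: w -> k != i -> 0 <= v k 0 * v' k 0)].
Proof.
move=> LD L2 L1 ew /set0Pn [j jw].
have eJ : e \in e |: w by rewrite setU11.
have wJ k : k \in w -> k \in e |: w by exact: setU1r.
have we k : k \in w -> k != e by apply: contraTneq => ->.
have we0 u k : L u -> k \in w -> u k 0 = 0 -> u e 0 = 0 -> u = 0.
  by move=> Lu kw; apply: L2 => //; [exact: wJ | exact: we].
have /choice [R RP] : forall i, exists r : 'cV[int]_n, i \in w ->
    [/\ L r, r i 0 = 0, 0 < r e 0 &
      forall v, L v -> v i 0 = 0 -> exists q, v = q *: r].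
  move=> i; have [iw|] := boolP (i \in w); last by exists 0.
  have [||r [[Lr ri] re rdvd]] :=
    @exists_coord_generator _ (fun u => L u /\ u i 0 = 0) e.
  - by move=> a b u v [Lu ui] [Lv vi]; split; rewrite ?mxE ?ui ?vi ?mulr0 ?addr0; auto.
  - have [u Lu [u0 ui]] := L1 i (wJ i iw).
    by exists u => //; apply: contraNneq u0 => ue; apply/eqP/(we0 u i).
  exists r => _; split=> // v Lv vi; exists (v e 0%R %/ r e 0%R)%Z; apply/eqP.
  rewrite -subr_eq0 -[v]scale1r -scaleNr; apply/eqP/(we0 _ i) => //.
  - exact: LD.
  - by rewrite !mxE vi ri !mulr0 addr0.
  - by rewrite !mxE mulNr mul1r divzK ?subrr // rdvd.
have [c Lc [c0 ce]] := L1 e eJ.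
have cw k : k \in w -> c k 0 != 0.
  by move=> kw; apply: contraNneq c0 => ck; apply/eqP/(we0 c k).
(* The case h_e = 0 only gives r_k = r_i + a h with the same e-th coordinate;
   the tie is broken by the j-th coordinate, signed by c. *)
have [i [iw maxe maxj]] : exists i, [/\ i \in w,
    forall k, k \in w -> R k e 0 <= R i e 0 &
    forall k, k \in w -> R k e 0 = R i e 0 ->
      R k j 0 * c j 0 <= R i j 0 * c j 0].
  case: (@arg_maxP _ _ _ j (fun k => k \in w) (fun k => R k e 0) jw) => i1 i1w max1.
  pose Q k := (k \in w) && (R k e 0 == R i1 e 0).
  have Qi1 : Q i1 by rewrite /Q i1w eqxx.
  case: (@arg_maxP _ _ _ i1 Q (fun k => R k j 0 * c j 0) Qi1) => i2 /andP[i2w /eqP e2] max2.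
  exists i2; split=> // k kw; rewrite e2; first exact: max1.
  by move=> ek; apply: max2; rewrite /Q kw ek eqxx.
have [Lr ri re rgen] := RP i iw; set r := R i in Lr ri re rgen maxe maxj.
have [|h0 [Lh0 h0i h0dvd]] := @exists_coord_generator _ L i LD.
  by exists c => //; apply: cw.
(* [sc] gives [h] the sign of [c] at [i], as the tie-break needs. Subtracting [q *: r] reduces the
   [e]-th coordinate modulo [r e 0] and keeps the [i]-th, because [r i 0 = 0]. *)
pose sc := Num.sg (c i 0); pose q := ((sc * h0 e 0)%R %/ r e 0%R)%Z.
pose h : 'cV[int]_n := sc *: h0 + (- q) *: r.
have Lh : L h by exact: LD.
have hE k : h k 0 = sc * h0 k 0 - q * r k 0 by rewrite !mxE mulNr.
have hi : h i 0 = sc * h0 i 0 by rewrite hE ri mulr0 subr0.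
have he : h e 0 = ((sc * h0 e 0)%R %% r e 0%R)%Z by rewrite hE.
have he0 : 0 <= h e 0 by rewrite he modz_ge0 // gt_eqF.
have her : h e 0 < r e 0 by rewrite he ltz_pmod.
have ci := cw i iw.
have sc2 : sc * sc = 1 by rewrite /sc; nia.
have hci : 0 < h i 0 * c i 0 by rewrite hi /sc; nia.
have span x : L x -> exists a b, x = a *: h + b *: r.
  move=> Lx; have /dvdzP [q' xq] := h0dvd x Lx.
  (* With this [a], [x - a *: h] vanishes at [i], hence is a multiple of [r]. *)
  pose a := q' * sc.
  have [||b xb] := rgen (1 *: x + (- a) *: h); first exact: LD.
    by rewrite 2!mxE [(_ *: h) _ _]mxE hi xq /a; nia.
  by exists a, b; rewrite -xb scale1r scaleNr addrC subrK.
have rw k : k \in w -> k != i -> r k 0 != 0.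
  move=> kw ki; apply/eqP => rk; have r0 : r = 0 by apply: (L2 r k i); rewrite ?wJ.
  by rewrite r0 mxE in re.
have same_sign (a b x y : int) : a * x + b * y = 0 -> x * y < 0 ->
    [\/ a = 0 /\ b = 0, 0 < a /\ 0 < b | a < 0 /\ b < 0].
  move=> abxy xy; have y2 : 0 < y * y by nia.
  have E : b * (y * y) = - a * (x * y).
    by have := congr1 ( *%R^~ y) abxy; rewrite mul0r; lia.
  have [a0|a0|a0] := ltgtP a 0.
  - by constructor 3; split=> //; nia.
  - by constructor 2; split=> //; nia.
  - by constructor 1; split=> //; nia.
have hr k : k \in w -> k != i -> 0 <= h k 0 * r k 0.
  move=> kw ki; rewrite leNgt; apply/negP => hrk.
  have [Lx xk xe _] := RP k kw; have [a [b xab]] := span _ Lx.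
  have xE l : R k l 0 = a * h l 0 + b * r l 0 by rewrite xab !mxE.
  have maxk := maxe k kw; have tie := maxj k kw.
  rewrite xE in xk; rewrite !xE in xe maxk tie.
  (* Since [0 <= h e 0] and [0 < r e 0], positivity of [R k e 0] leaves only [a, b >= 1]; maximality
     then forces [h e 0 = 0] and [b = 1]. *)
  have [[a0 b0]|[a0 b0]|[a0 b0]] := same_sign _ _ _ _ xk hrk; [nia| |nia].
  have hre : h e 0 = 0 by nia.
  have b1 : b = 1 by nia.
  (* Both [h] and [c] now vanish at [e], so they are proportional, with equal signs at [j] as at
     [i]. Adding [a *: h] to [r] would then increase the tie-break value. *)
  have hc : c i 0 *: h = h i 0 *: c.
    apply/eqP; rewrite -subr_eq0 -scaleNr; apply/eqP/(we0 _ i) => //.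
    - exact: LD.
    - by rewrite !mxE; ring.
    - by rewrite mxE [X in X + _]mxE [X in _ + X]mxE hre ce !mulr0 addr0.
  have hcj : c i 0 * h j 0 = h i 0 * c j 0 by have /colP/(_ j) := hc; rewrite !mxE.
  have cj := cw j jw.
  have hj : 0 < h j 0 * c j 0.
    have : 0 < (c i 0 * h j 0) * (c i 0 * c j 0).
      rewrite hcj; have -> : h i 0 * c j 0 * (c i 0 * c j 0)
        = (h i 0 * c i 0) * (c j 0 * c j 0) by ring.
      by rewrite mulr_gt0 //; nia.
    by nia.
  by have := tie _; nia.
have gr k : k \in w -> k != i -> 0 <= (r k 0 - h k 0) * r k 0.
  move=> kw ki; rewrite leNgt; apply/negP => grk.
  have [Lx xk xe _] := RP k kw; have [a [b xab]] := span _ Lx.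
  (* In the basis [r], [r - h] no tie can occur: [r e 0 - h e 0] is strictly positive, so
     coefficients at least 1 already exceed the maximum. *)
  have xE l : R k l 0 = (a + b) * r l 0 + (- a) * (r l 0 - h l 0) by rewrite xab !mxE; ring.
  have maxk := maxe k kw; rewrite xE in xk; rewrite !xE in xe maxk.
  rewrite mulrC in grk.
  have [[a0 b0]|[a0 b0]|[a0 b0]] := same_sign _ _ _ _ xk grk; nia.
pose g : 'cV[int]_n := 1 *: r + (-1) *: h.
have Lg : L g by exact: LD.
have hg : h + g = r by rewrite /g scale1r scaleN1r addrC subrK.
have gE k : g k 0 = r k 0 - h k 0 by rewrite mxE [X in X + _]mxE [X in _ + X]mxE; ring.
have pos k : k \in e |: w -> k != i -> 0 <= h k 0 * g k 0.
  rewrite gE => /setU1P [-> _|kw ki]; first by rewrite mulr_ge0 //; lia.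
  by have := hr k kw ki; have := gr k kw ki; have := rw k kw ki; nia.
have [hneg|hpos] : h i 0 < 0 \/ 0 < h i 0 by nia.
- exists i, h, g; split=> //; last by rewrite hg.
  by rewrite !gE ri; split; lia.
- exists i, g, h; split=> //.
    by rewrite !gE ri; split; lia.
  by rewrite addrC hg; split=> // k kJ ki; rewrite mulrC pos.
Qed.

(** * Conformality as a sign condition, and the kernel of [Lambda_del] *)

Lemma max0_additive (x y : int) :
  (Num.max (x + y) 0 = Num.max x 0 + Num.max y 0 /\
   Num.max (- (x + y)) 0 = Num.max (- x) 0 + Num.max (- y) 0) <-> 0 <= x * y.
Proof.
by case: (lerP 0 x) => x0; case: (lerP 0 y) => y0; split=> [[? ?]|?];
  try split; nia.
Qed.

Lemma conformalP n (v w : 'cV[int]_n) :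
  conformal v w <-> forall i, 0 <= v i 0 * w i 0.
Proof.
split=> [[/matrixP pos /matrixP neg] i | vw].
  by apply/max0_additive; have := pos i 0; have := neg i 0; rewrite !mxE.
by split; apply/colP => i; have /max0_additive [] := vw i; rewrite !mxE.
Qed.

(** The deleted columns vanish on the retained rows, so the deleted entries of [X] do not contribute
    to these rows of the product. *)
Lemma mul_delete m n p (R : {set 'I_m}) (C : {set 'I_n}) (A : 'M[int]_(m, n))
    (X : 'M[int]_(n, p)) :
  (forall i k, i \notin R -> k \in C -> A i k = 0) ->
  delete R C A *m rowsub (fun j : 'I_#|~: C| => enum_val j) X =
  rowsub (fun i : 'I_#|~: R| => enum_val i) (A *m X).
Proof.
move=> A0; apply/matrixP => a b; rewrite !mxE.
rewrite [RHS](bigID [in ~: C]) /= [X in _ = _ + X]big1 ?addr0; last first.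
  move=> k; rewrite inE negbK => kC; rewrite A0 ?mul0r //.
  by have := enum_valP a; rewrite inE.
by rewrite [RHS]big_enum_val; apply: eq_bigr => j _; rewrite !mxE.
Qed.

Definition lift_ker s (W : {set 'I_s}) (u : 'cV[int]_s) :
    'cV[int]_#|~: [set rshift s i | i in W]| :=
  rowsub (fun j => enum_val j) (col_mx u (- u)).

Lemma mem_rshift m s (W : {set 'I_s}) i :
  (rshift m i \in [set rshift m i | i in W]) = (i \in W).
Proof. by rewrite mem_imset //; apply: rshift_inj. Qed.

Lemma lshift_notin m s (W : {set 'I_s}) (i : 'I_m) :
  lshift s i \notin [set rshift m i | i in W].
Proof. by apply/imsetP => -[k _ /eqP]; rewrite eq_lrshift. Qed.

Lemma mul_Lambda_del m s (T : 'M[int]_(m, s)) (W : {set 'I_s})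
    (X : 'cV[int]_(s + s)) :
  Lambda_del T W *m rowsub (fun j => enum_val j) X =
  rowsub (fun j => enum_val j) (Lambda T *m X).
Proof.
(* The only nonzero entry of column [rshift s k] is in row [rshift m k], which is deleted with
   it. *)
apply: mul_delete => i _ iR /imsetP [k kW ->].
move: iR; case: (fintype.splitP i) => [a ia|a ia].
  have -> : i = lshift s a by apply: val_inj.
  by rewrite block_mxEur mxE.
have -> : i = rshift m a by apply: val_inj.
rewrite mem_rshift block_mxEdr mxE => aW; case: eqP => // ak.
by rewrite ak kW in aW.
Qed.

Lemma lift_ker_in_ker m s (T : 'M[int]_(m, s)) (W : {set 'I_s}) u :
  in_ker T u -> in_ker (Lambda_del T W) (lift_ker W u).
Proof.
move=> Tu; rewrite /in_ker mul_Lambda_del mul_block_col Tu !mul1mx mul0mx.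
by rewrite addr0 subrr; apply/matrixP => i j; rewrite !mxE; case: splitP => k _; rewrite mxE.
Qed.

Lemma Lambda_del_kerP m s (T : 'M[int]_(m, s)) (W : {set 'I_s}) V :
  in_ker (Lambda_del T W) V -> exists2 u, in_ker T u & V = lift_ker W u.
Proof.
set C := [set rshift s i | i in W] in V *.
pose f (j : 'I_#|~: C|) : 'I_(s + s) := enum_val j.
have [X VX] : exists X, V = rowsub f X.
  (* Deleted coordinates are filled with the default value 0. *)
  exists (\col_q (if [pick j | f j == q] is Some j then V j 0 else 0)).
  apply/colP => j; rewrite !mxE.
  by case: pickP => [k /eqP /enum_val_inj -> //|/(_ j)]; rewrite eqxx.
rewrite /in_ker {1}VX mul_Lambda_del => /matrixP LX.
have row0 i : i \notin [set rshift m i | i in W] -> (Lambda T *m X) i 0 = 0.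
  move=> iR; have iC : i \in ~: [set rshift m i | i in W] by rewrite inE.
  by have := LX (enum_rank_in iC i) 0; rewrite !mxE enum_rankK_in.
rewrite -[X]vsubmxK mul_block_col !mul1mx mul0mx addr0 in row0.
exists (usubmx X).
  by apply/colP => i; have := row0 _ (lshift_notin W i); rewrite col_mxEu => ->; rewrite mxE.
apply/colP => j; rewrite VX -{1}[X]vsubmxK [LHS]mxE [RHS]mxE /f.
have := enum_valP j; case: (fintype.splitP (enum_val j)) => a ja.
  have -> : enum_val j = lshift s a by apply: val_inj.
  by rewrite !col_mxEu.
have -> : enum_val j = rshift s a by apply: val_inj.
rewrite inE mem_rshift !col_mxEd => aW.
have /row0 : rshift m a \notin [set rshift m i | i in W] by rewrite mem_rshift.
by rewrite col_mxEd !mxE addrC => /eqP; rewrite addr_eq0 => /eqP.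
Qed.

Lemma lift_kerD s (W : {set 'I_s}) u v :
  lift_ker W (u + v) = lift_ker W u + lift_ker W v.
Proof. by rewrite /lift_ker opprD -add_col_mx; apply/matrixP => i j; rewrite !mxE. Qed.

Lemma lift_ker_lshift s (W : {set 'I_s}) i :
  exists j, forall u, lift_ker W u j 0 = u i 0.
Proof.
have iC : lshift s i \in ~: [set rshift s i | i in W] by rewrite inE lshift_notin.
by exists (enum_rank_in iC (lshift s i)) => u; rewrite mxE enum_rankK_in // col_mxEu.
Qed.

Lemma lift_ker_coord s (W : {set 'I_s}) j :
  exists i, (forall u, lift_ker W u j 0 = u i 0) \/
            (i \notin W /\ forall u, lift_ker W u j 0 = - u i 0).
Proof.
have := enum_valP j; case: (fintype.splitP (enum_val j)) => a ja.
  have ej : enum_val j = lshift s a by apply: val_inj.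
  by exists a; left => u; rewrite mxE ej col_mxEu.
have ej : enum_val j = rshift s a by apply: val_inj.
rewrite ej inE mem_rshift => aW.
by exists a; right; split=> // u; rewrite mxE ej col_mxEd mxE.
Qed.

Lemma lift_ker_inj s (W : {set 'I_s}) : injective (lift_ker W).
Proof.
move=> u v /colP uv; apply/colP => i; have [j ji] := lift_ker_lshift W i.
by rewrite -!ji uv.
Qed.

Lemma lift_ker_eq0 s (W : {set 'I_s}) u : (lift_ker W u == 0) = (u == 0).
Proof.
have l0 : lift_ker W 0 = 0.
  by apply: (addrI (lift_ker W 0)); rewrite -lift_kerD !addr0.
by rewrite -{1}l0 (inj_eq (@lift_ker_inj _ W)).
Qed.

Lemma graver_lift_ker m s (T : 'M[int]_(m, s)) (W : {set 'I_s}) u :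
  graver T u -> graver (Lambda_del T W) (lift_ker W u).
Proof.
move=> [Tu u0 indec]; split; [exact: lift_ker_in_ker | by rewrite lift_ker_eq0 |].
move=> [_ [_ [[/Lambda_del_kerP [v Tv ->] /Lambda_del_kerP [w Tw ->]]]]].
rewrite !lift_ker_eq0 -lift_kerD => vw0 /lift_ker_inj uvw /conformalP vw.
apply: indec; exists v, w; split=> //; apply/conformalP => i.
by have [j ji] := lift_ker_lshift W i; rewrite -!ji.
Qed.

(** Off [W] both [u i 0] and its negative are coordinates of the lift, so semiconformality there
    excludes both sign clashes; on [W] only one clash is excluded. *)
Lemma not_strongly_robust_Lambda_del m s (T : 'M[int]_(m, s)) (W : {set 'I_s})
    (v w : 'cV[int]_s) :
  graver T (v + w) -> in_ker T v -> in_ker T w -> v != 0 -> w != 0 ->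
  (forall i, i \in W -> 0 < v i 0 -> 0 <= w i 0) ->
  (forall i, i \notin W -> 0 <= v i 0 * w i 0) ->
  ~ strongly_robust (Lambda_del T W).
Proof.
move=> gr Tv Tw v0 w0 semi conf rob.
have /rob [_ _ indec] := graver_lift_ker W gr.
apply: indec; exists (lift_ker W v), (lift_ker W w); split.
- by split; apply: lift_ker_in_ker.
- by rewrite !lift_ker_eq0.
- exact: lift_kerD.
move=> j; have [i [ji|[iW ji]]] := lift_ker_coord j; rewrite !ji.
  have [iW|iW] := boolP (i \in W); first by have := semi i iW; lia.
  by have := conf i iW; nia.
by have := conf i iW; nia.
Qed.

(** * The bound on the size of a face *)

Lemma strongly_robust_card d s (T : 'M[int]_(d, s)) (W : {set 'I_s}) :
  general_position T -> strongly_robust (Lambda_del T W) -> (#|W| <= d)%N.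
Proof.
move=> gT rob; rewrite leqNgt; apply/negP => dW.
have [ds _] := gT.
pose w := [set i in take d.+1 (enum W)].
have wd : #|w| = d.+1.
  rewrite cardsE; have /card_uniqP -> : uniq (take d.+1 (enum W)).
    by rewrite take_uniq // enum_uniq.
  by rewrite size_takel // -cardE.
have wW k : k \in w -> k \in W by rewrite inE => /mem_take; rewrite mem_enum.
(* This uses [d + 2 <= s]. The index [e] may lie in [W]; the summands found below agree in sign
   there anyway. *)
have [e ew] : exists e, e \notin w.
  apply/existsP; rewrite -negb_forall; apply/negP => /forallP allw.
  have : (#|'I_s| <= #|w|)%N by apply/subset_leq_card/subsetP => k _; apply: allw.
  by rewrite card_ord wd; lia.
pose J := e |: w.
have Jd : #|J| = d.+2 by rewrite cardsU1 ew wd.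
pose L (u : 'cV[int]_s) := in_ker T u /\ forall k, k \notin J -> u k 0 = 0.
(* Two zeros on [J] leave a support inside [d] indices, whose columns are independent. *)
have L2 u i k : L u -> i \in J -> k \in J -> i != k ->
    u i 0 = 0 -> u k 0 = 0 -> u = 0.
  move=> [Tu uJ] iJ kJ ik ui uk.
  apply: (@general_position_ker _ _ T ((J :\ i) :\ k)) => //.
    have := cardsD1 i J; have := cardsD1 k (J :\ i).
    by rewrite Jd iJ in_setD1 eq_sym ik kJ; lia.
  move=> l; rewrite !in_setD1 !negb_and !negbK => /or3P [/eqP -> //|/eqP -> //|].
  exact: uJ.
have [|i iJ|||i [v [v' [iw [Tv vJ] [Tv' vJ'] [vi vvi vve] [gen conf]]]]] :=
  @exists_decomposable_circuit _ L w e _ L2.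
- move=> a b u x [Tu uJ] [Tx xJ]; split.
    by rewrite /in_ker mulmxDr -!scalemxAr Tu Tx !scaler0 addr0.
  by move=> k kJ; rewrite !mxE uJ // xJ // !mulr0 addr0.
(* The [d + 1] columns left after removing [i] from [J] are dependent. *)
- have [|u u0 [Tu uS]] := @exists_dependency _ _ T (J :\ i).
    by have := cardsD1 i J; rewrite Jd iJ add1n => -[<-].
  exists u; split=> //; last by apply: uS; rewrite setD11.
  by move=> k kJ; apply: uS; rewrite in_setD1 negb_and kJ orbT.
- exact: ew.
- by rewrite -card_gt0 wd.
have neq0 (x : 'cV[int]_s) : x i 0 != 0 -> x != 0.
  by apply: contraNneq => ->; rewrite mxE.
have off k : k != i -> 0 <= v k 0 * v' k 0.
  have [kJ|kJ _] := boolP (k \in J); first exact: conf.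
  by rewrite vJ // mul0r.
apply: (@not_strongly_robust_Lambda_del _ _ T W v v' _ _ _ _ _ _ _ rob) => //.
- have rJ k : k \notin J -> (v + v') k 0 = 0 by move=> kJ; rewrite mxE vJ ?vJ' ?addr0.
  split; first by rewrite /in_ker mulmxDr Tv Tv' addr0.
    by apply: contraTneq vve => r0; have /colP/(_ e) := r0; rewrite !mxE => ->.
  (* Conformal summands of a circuit are supported in it, hence are multiples
     of it, of the same sign. *)
  move=> [x [y [[Tx Ty] [x0 y0] rxy /conformalP xy]]].
  have coord k : (v + v') k 0 = x k 0 + y k 0 by rewrite rxy mxE.
  have zero k : (v + v') k 0 = 0 -> x k 0 = 0 /\ y k 0 = 0.
    by rewrite coord; have := xy k; nia.
  have ri : (v + v') i 0 = 0 by rewrite mxE.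
  have [a xa] : exists a, x = a *: (v + v').
    by apply: gen; [split=> // k /rJ /zero [] | have [] := zero i ri].
  have [b yb] : exists b, y = b *: (v + v').
    by apply: gen; [split=> // k /rJ /zero [] | have [] := zero i ri].
  have rE : (v + v') e 0 = v e 0 + v' e 0 by rewrite mxE.
  have xe : x e 0 = a * (v e 0 + v' e 0) by rewrite xa mxE rE.
  have ye : y e 0 = b * (v e 0 + v' e 0) by rewrite yb mxE rE.
  have := coord e; have := xy e; rewrite rE xe ye => ab0 ab1.
  have a0 : a != 0 by apply: contraNneq x0 => a0; rewrite xa a0 scale0r.
  have b0 : b != 0 by apply: contraNneq y0 => b0; rewrite yb b0 scale0r.
  (* Two nonzero integers of the same sign cannot have sum 1. *)
  have {}ab1 : a + b = 1 by nia.
  rewrite mulrACA pmulr_lge0 ?mulr_gt0 // in ab0.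
  by nia.
- by apply: neq0; lia.
- by apply: neq0; lia.
- move=> k _; have [-> |/off] := eqVneq k i; first by lia.
  by nia.
- by move=> k kW; apply: off; apply: contraNneq kW => ->; apply: wW.
Qed.

Theorem theorem3p4 (d s : nat) (T : 'M[int]_(d, s)) (hd : (1 <= d)%N)
    (hgen : general_position T) (hvertex : has_vertex T) :
  complex_dim (strongly_robust_complex T) < (\rank (ratmx T))%:Z.
Proof.
rewrite general_position_rank // /complex_dim.
suff : (\max_(w in strongly_robust_complex T) #|w| <= d)%N by lia.
apply/bigmax_leqP => W; rewrite inE => /asboolP.
exact: strongly_robust_card.
Qed.
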